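(* Let $\mathcal{A}$ and $\mathfrak{A}$ be Banach algebras such that $\mathcal{A}$ is a Banach $\mathfrak{A}$-bimodule with compatible actions. Assume that $\mathfrak{A}$ acts on $\mathcal{A}$ trivially from the left and that $\mathcal{A}/J$ has a left identity. If $\mathcal{A}$ is biprojective, then $\mathcal{A}$ is module biprojective (as an $\mathfrak{A}$-module).
   Context: Compatible actions: $\alpha\cdot(ab)=(\alpha\cdot a)b$ and $(ab)\cdot\alpha=a(b\cdot\alpha)$ for $a,b\in\mathcal{A}$, $\alpha\in\mathfrak{A}$. $\mathfrak{A}$ acts trivially on $\mathcal{A}$ from the left if there is a continuous linear functional $f$ on $\mathfrak{A}$ with $\alpha\cdot a=f(\alpha)a$ for all $\alpha\in\mathfrak{A}$, $a\in\mathcal{A}$. The projective tensor product $\mathcal{A}\widehat{\bigotimes}\mathcal{A}$ is a Banach algebra with $(a\otimes b)(c\otimes d)=ac\otimes bd$, and carries the canonical actions $a\cdot(b\otimes c)=ab\otimes c$, $(b\otimes c)\cdot a=b\otimes ca$, $\alpha\cdot(b\otimes c)=(\alpha\cdot b)\otimes c$, $(b\otimes c)\cdot\alpha=b\otimes(c\cdot\alpha)$. Let $I$ be the closed ideal of $\mathcal{A}\widehat{\bigotimes}\mathcal{A}$ generated by the elements $\alpha\cdot a\otimes b-a\otimes b\cdot\alpha$ ($\alpha\in\mathfrak{A}$, $a,b\in\mathcal{A}$). Let $\omega:\mathcal{A}\widehat{\bigotimes}\mathcal{A}\to\mathcal{A}$ be the bounded linear map with $\omega(a\otimes b)=ab$,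 and let $J$ be the closed ideal of $\mathcal{A}$ generated by $\omega(I)$ (that is, by the elements $\alpha\cdot(ab)-(ab)\cdot\alpha$). The quotients $(\mathcal{A}\widehat{\bigotimes}\mathcal{A})/I$ and $\mathcal{A}/J$ carry the induced actions of $\mathfrak{A}$ and $\mathcal{A}$. Let $\widetilde{\omega}:(\mathcal{A}\widehat{\bigotimes}\mathcal{A})/I\to\mathcal{A}/J$ be the induced map, $\widetilde{\omega}(a\otimes b+I)=ab+J$. An $\mathcal{A}/J$-$\mathfrak{A}$-module morphism $\varphi:X\to Y$ is a norm-continuous additive map (not assumed $\mathbb{C}$-linear) with $\varphi(\alpha\cdot x)=\alpha\cdot\varphi(x)$, $\varphi(x\cdot\alpha)=\varphi(x)\cdot\alpha$ for $\alpha\in\mathfrak{A}$, and commuting with the left and right actions of $\mathcal{A}/J$, where $a+J$ acts as $a\in\mathcal{A}$ does (i.e. $\varphi(a\cdot x)=a\cdot\varphi(x)$ and $\varphi(x\cdot a)=\varphi(x)\cdot a$ for $a\in\mathcal{A}$). $\mathcal{A}$ is biprojective if $\omega$ has a bounded right inverse which is an $\mathcal{A}$-bimodule homomorphism. $\mathcal{A}$ is module biprojective (as an $\mathfrak{A}$-module) if $\widetilde{\omega}$ has a bounded right inverse which is an $\mathcal{A}/J$-$\mathfrak{A}$-module morphism. *)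

(* Defs.v *)
From HB Require Import structures.
From mathcomp Require Import all_boot all_order all_algebra.
From mathcomp Require Import generic_quotient.
From mathcomp Require Import all_classical all_reals.
From mathcomp Require Import interval_inference topology normedtype sequences.
From mathcomp Require Import complex freeg.

Set Implicit Arguments.
Unset Strict Implicit.
Unset Printing Implicit Defensive.

Import Order.TTheory GRing.Theory Num.Theory.
Import numFieldNormedType.Exports.

Local Open Scope classical_set_scope.
Local Open Scope ring_scope.
Local Open Scope quotient_scope.
Local Open Scope complex_scope.

(* The norm of a normed space over R[i] takes its values in R[i]; rnorm is the
   same norm as an element of R. *)
Definition rnorm (R : realType) (V : normedZmodType R[i]) (x : V) : R :=
  complex.Re `|x|.

Section RealNorm.
Variables (R : realType) (V : normedModType R[i]).
Implicit Types x y : V.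

Lemma rnormE x : `|x| = (rnorm x)%:C.
Proof. by rewrite /rnorm RRe_real // ger0_real. Qed.

Lemma rnorm_ge0 x : 0 <= rnorm x.
Proof. by rewrite -ler0c -rnormE. Qed.

Lemma rnormD x y : rnorm (x + y) <= rnorm x + rnorm y.
Proof. by rewrite -lecR rmorphD /= -!rnormE ler_normD. Qed.

Lemma rnormN x : rnorm (- x) = rnorm x.
Proof. by rewrite /rnorm normrN. Qed.

Lemma rnorm0 : rnorm (0 : V) = 0.
Proof. by rewrite /rnorm normr0. Qed.

Lemma rnormZ (c : R[i]) x : rnorm (c *: x) = rnorm c * rnorm x.
Proof.
by apply: complexI; rewrite rmorphM /= -!rnormE normrZ.
Qed.

Lemma rnorm_le x y : (`|x| <= `|y|) = (rnorm x <= rnorm y).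
Proof. by rewrite !rnormE lecR. Qed.

End RealNorm.

Lemma rnorm_scalarE (R : realType) (c : R[i]) : `|c| = (rnorm c)%:C.
Proof. by rewrite /rnorm RRe_real // ger0_real. Qed.

Section Gauge.
Variables (R : realType) (V : lmodType R[i]) (W : Type).
Variables (g : W -> R) (r : W -> V).

Definition gauge (x : V) : R := inf [set g w | w in [set w | r w = x]].

Variables (wadd : W -> W -> W) (wscale : R[i] -> W -> W).
Hypothesis g_ge0 : forall w, 0 <= g w.
Hypothesis r_surj : forall x, exists w, r w = x.
Hypothesis rD : forall v w, r (wadd v w) = r v + r w.
Hypothesis gD : forall v w, g (wadd v w) <= g v + g w.
Hypothesis rZ : forall c w, r (wscale c w) = c *: r w.
Hypothesis gZ : forall c w, g (wscale c w) <= rnorm c * g w.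

Let has_inf_gauge x : has_inf [set g w | w in [set w | r w = x]].
Proof.
split; last by exists 0 => _ [w _ <-].
by have [w rw] := r_surj x; exists (g w), w.
Qed.

Lemma gauge_le w : gauge (r w) <= g w.
Proof. by apply: ge_inf; [have [] := has_inf_gauge (r w)|exists w]. Qed.

Lemma gauge_ge x m : (forall w, r w = x -> m <= g w) -> m <= gauge x.
Proof.
move=> h; apply: lb_le_inf; first by have [] := has_inf_gauge x.
by move=> _ [w rw <-]; exact: h.
Qed.

Lemma gauge_ge0 x : 0 <= gauge x.
Proof. by apply: gauge_ge => w _; exact: g_ge0. Qed.

Lemma gauge_lt x e : 0 < e -> exists2 w, r w = x & g w < gauge x + e.
Proof.
move=> e0; have [_ [w rw <-] lt] := inf_adherent e0 (has_inf_gauge x).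
by exists w.
Qed.

Lemma gaugeD x y : gauge (x + y) <= gauge x + gauge y.
Proof.
apply/ler_addgt0Pr => e e0; have e20 : 0 < e / 2 by rewrite divr_gt0.
have [v rv gv] := gauge_lt x e20; have [w rw gw] := gauge_lt y e20.
rewrite -rv -rw -rD (le_trans (gauge_le _)) // (le_trans (gD _ _)) //.
by rewrite rv rw (splitr e) addrACA lerD // ltW.
Qed.


Lemma gaugeZ c x : gauge (c *: x) = rnorm c * gauge x.
Proof.
have c0 a : 0 <= rnorm (a : R[i]) by rewrite -ler0c -rnorm_scalarE.
have le a z : gauge (a *: z) <= rnorm a * gauge z.
  apply/ler_addgt0Pr => e e0.
  have d0 : 0 < e / (rnorm a + 1) by rewrite divr_gt0 // ltr_wpDl.
  have [w rw gw] := gauge_lt z d0.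
  rewrite -rw -rZ (le_trans (gauge_le _)) // (le_trans (gZ _ _)) //.
  rewrite rw (le_trans (ler_wpM2l (c0 a) (ltW gw))) // mulrDr lerD2l.
  rewrite mulrCA ger_pMr // ler_pdivrMr ?ltr_wpDl // mul1r.
  by rewrite lerDl.
apply/le_anti/andP; split; first exact: le.
have [->|cn0] := eqVneq c 0.
  by rewrite /rnorm normr0 mul0r gauge_ge0.
have nc0 : 0 < rnorm c by rewrite -ltcR -rnorm_scalarE normr_gt0.
rewrite -[leLHS]mulrC -ler_pdivlMr // mulrC.
have := le c^-1 (c *: x); rewrite scalerA mulVf // scale1r.
suff -> : rnorm (c^-1) = (rnorm c)^-1 by [].
by apply: complexI; rewrite fmorphV /= -!rnorm_scalarE normfV.
Qed.

End Gauge.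

Section SubmodOpp.
Variables (K : pzRingType) (V : lmodType K) (S : submodClosed V).

(* [submodClosed] is also available over semirings, so that it does not inherit
   from [zmodClosed]. *)
Definition zsub : {pred V} := S.

Lemma zsub_zmod_closed : zmod_closed zsub.
Proof.
split=> [|x y]; first exact: (@rpred0 _ S).
by move=> Sx Sy; apply: (@rpredD _ S) => //; rewrite -scaleN1r (@rpredZ _ _ S).
Qed.
HB.instance Definition _ := GRing.isZmodClosed.Build V zsub zsub_zmod_closed.

End SubmodOpp.

Section LQuot.
Variables (K : pzRingType) (V : lmodType K) (S : submodClosed V).

Definition lquot : Type := Quotient.quot (zsub S).
HB.instance Definition _ := GRing.Zmodule.on lquot.

Definition qpi (x : V) : lquot := \pi_(Quotient.quot (zsub S)) x.
Definition qrep (x : lquot) : V := repr (x : Quotient.quot (zsub S)).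

Lemma qrepK x : qpi (qrep x) = x.
Proof. exact: reprK. Qed.

Lemma qpi_eq x y : (qpi x = qpi y) <-> (x - y \in S).
Proof.
rewrite -[_ \in S]/(x - y \in zsub S) Quotient.idealrBE.
by split=> [e|/eqP//]; apply/eqP.
Qed.

Lemma qpiD x y : qpi (x + y) = qpi x + qpi y.
Proof. exact: (raddfD \pi_(Quotient.quot (zsub S))). Qed.

Lemma qpi_rep x : qrep (qpi x) - x \in S.
Proof. by apply/qpi_eq; rewrite qrepK. Qed.

Definition qscale (c : K) (x : lquot) : lquot := qpi (c *: qrep x).

Lemma qscale_pi c x : qscale c (qpi x) = qpi (c *: x).
Proof. by apply/qpi_eq; rewrite -scalerBr (@rpredZ _ _ S) // qpi_rep. Qed.

Let qscaleA a b v : qscale a (qscale b v) = qscale (a * b) v.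
Proof. by rewrite -[v]qrepK !qscale_pi scalerA. Qed.
Let qscale1 : left_id 1 qscale.
Proof. by move=> v; rewrite -[v]qrepK qscale_pi scale1r. Qed.
Let qscaleDr : right_distributive qscale +%R.
Proof.
by move=> c x y; rewrite -[x]qrepK -[y]qrepK -qpiD !qscale_pi scalerDr qpiD.
Qed.
Let qscaleDl v : {morph qscale^~ v : a b / a + b}.
Proof. by move=> a b; rewrite -[v]qrepK !qscale_pi scalerDl qpiD. Qed.

HB.instance Definition _ := GRing.Zmodule_isLmodule.Build K lquot
  qscaleA qscale1 qscaleDr qscaleDl.

Lemma qpi_is_linear : linear qpi.
Proof. by move=> c x y; rewrite qpiD -qscale_pi. Qed.
HB.instance Definition _ := GRing.isLinear.Build K V lquot *:%R qpi qpi_is_linear.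

Lemma qpi_eq0 x : (qpi x = 0) <-> (x \in S).
Proof. by rewrite -[0](raddf0 qpi) qpi_eq subr0. Qed.

End LQuot.
Arguments qpi {K V} S x.
Arguments qrep {K V S} x.

Section LSpan.
Variables (K : pzRingType) (V : lmodType K) (S : set V).

Definition lspan : {pred V} := fun x =>
  `[< forall M : {pred V}, submod_closed M -> (forall y, S y -> y \in M) ->
      x \in M >].

Lemma lspan_submod_closed : submod_closed lspan.
Proof.
split=> [|c x y /asboolP hx /asboolP hy]; apply/asboolP => M Mc SM.
  by case: Mc.
by case: (Mc) => _; apply; [exact: hx|exact: hy].
Qed.
HB.instance Definition _ := GRing.isSubmodClosed.Build K V lspan
  lspan_submod_closed.

Lemma lspan_gen x : S x -> x \in lspan.
Proof. by move=> Sx; apply/asboolP => M _; exact. Qed.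

Lemma lspan_min (M : {pred V}) : submod_closed M ->
  (forall y, S y -> y \in M) -> {subset lspan <= M}.
Proof. by move=> Mc SM x /asboolP; exact. Qed.

End LSpan.

HB.mixin Record isClosedPred (K : numFieldType) (V : normedModType K)
    (S : V -> bool) := {
  closed_subproof : closed [set x | S x]
}.

#[short(type="closedSubspace")]
HB.structure Definition ClosedSubspace (K : numFieldType) (V : normedModType K) :=
  {S of @GRing.SubmodClosed K V S & isClosedPred K V S}.

Section NQuot.
Variables (R : realType) (V : normedModType R[i]) (S : closedSubspace V).

Definition nquot : Type := lquot S.
HB.instance Definition _ := GRing.Lmodule.on nquot.

Definition npi (v : V) : nquot := qpi S v.
Lemma npi_is_linear : linear npi.
Proof. exact: qpi_is_linear. Qed.
HB.instance Definition _ := GRing.isLinear.Build R[i] V nquot *:%R npi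
  npi_is_linear.

Definition qnorm (x : nquot) : R := gauge (@rnorm R V) npi x.

Let npi_surj x : exists v, npi v = x.
Proof. by exists (qrep x); exact: qrepK. Qed.

Let qnormD x y : (qnorm (x + y))%:C <= (qnorm x)%:C + (qnorm y)%:C.
Proof.
rewrite -rmorphD lecR /qnorm; apply: (@gaugeD _ _ _ _ _ +%R) => //.
- exact: rnorm_ge0.
- exact: raddfD.
- exact: rnormD.
Qed.

Let qnormZ c x : (qnorm (c *: x))%:C = `|c| * (qnorm x)%:C.
Proof.
rewrite rnorm_scalarE -rmorphM /=; congr _%:C.
apply: (@gaugeZ _ _ _ _ _ *:%R) => //.
- exact: rnorm_ge0.
- by move=> a w; exact: linearZ.
- by move=> a w; rewrite rnormZ.
Qed.

Let qnorm0_eq0 x : (qnorm x)%:C = 0 -> x = 0.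
Proof.
move=> /complexI; rewrite -[x]qrepK -/(npi _); move: (qrep x) => v nv0.
apply/qpi_eq0; apply: (@closed_subproof _ _ S).
move=> B /nbhs_ballP[e /= e0 eB].
have e0' : 0 < complex.Re e by rewrite -ltcR RRe_real // gtr0_real.
have [w wv] := @gauge_lt _ _ _ (@rnorm R V) npi (@rnorm_ge0 _ _) npi_surj
  (npi v) _ e0'.
rewrite -/(qnorm _) nv0 add0r => we.
exists (v - w); split.
  by apply/qpi_eq; rewrite -/(npi w) wv.
apply: eB; rewrite -ball_normE /= opprB addrC subrK.
by rewrite rnormE -[e]RRe_real ?gtr0_real // ltcR.
Qed.

HB.instance Definition _ := Lmodule_isNormed.Build R[i] nquot
  qnormD qnormZ qnorm0_eq0.

Lemma nquot_normE (x : nquot) : `|x| = (qnorm x)%:C.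
Proof. by []. Qed.

Lemma npi_norm_le (v : V) : `|npi v| <= `|v|.
Proof.
rewrite nquot_normE rnormE lecR.
by apply: gauge_le => //; exact: rnorm_ge0.
Qed.

Lemma npi_eq x y : (npi x = npi y) <-> (x - y \in S).
Proof. exact: qpi_eq. Qed.

Lemma nrepK (x : nquot) : npi (qrep x) = x.
Proof. exact: qrepK. Qed.

End NQuot.
Arguments npi {R V} S v.

Record seminorm (R : realType) (V : lmodType R[i]) := Seminorm {
  seminorm_fun :> V -> R;
  seminormD : forall x y, seminorm_fun (x + y) <= seminorm_fun x + seminorm_fun y;
  seminormZ : forall (c : R[i]) x,
    seminorm_fun (c *: x) = rnorm c * seminorm_fun x
}.

Section SeminormTheory.
Variables (R : realType) (V : lmodType R[i]) (p : seminorm V).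

Lemma seminorm0 : p 0 = 0.
Proof. by rewrite -(scale0r 0) seminormZ /rnorm normr0 mul0r. Qed.

Lemma seminormN x : p (- x) = p x.
Proof. by rewrite -scaleN1r seminormZ /rnorm normrN1 mul1r. Qed.

Lemma seminorm_ge0 x : 0 <= p x.
Proof.
have := seminormD p x (- x); rewrite subrr seminorm0 seminormN -mulr2n.
by rewrite pmulrn_lge0.
Qed.

Lemma seminormB x y : p (x - y) = p (y - x).
Proof. by rewrite -opprB seminormN. Qed.

Lemma seminorm_dist x y : `|p x - p y| <= p (x - y).
Proof.
rewrite ler_norml lerBlDr; apply/andP; split.
  rewrite lerNl opprB lerBlDr seminormB.
  by have := seminormD p (y - x) x; rewrite subrK.
by have := seminormD p (x - y) y; rewrite subrK.
Qed.

End SeminormTheory.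

Section CauchySeq.
Variables (R : realType) (V : lmodType R[i]) (p : seminorm V).

Definition cauchy_wrt (u : nat -> V) : Prop :=
  forall e : R, 0 < e -> exists N, forall m n, (N <= m)%N -> (N <= n)%N ->
    p (u m - u n) < e.

Definition cauchy_seqs : {pred nat -> V} := fun u => `[< cauchy_wrt u >].

Lemma cauchy_seqs_submod_closed : submod_closed cauchy_seqs.
Proof.
split=> [|c u v /asboolP cu /asboolP cv]; apply/asboolP => e e0.
  by exists 0 => m n _ _; rewrite subrr seminorm0.
have nc0 : 0 <= rnorm c by rewrite -ler0c -rnorm_scalarE.
have d0 : 0 < e / (rnorm c + 1) by rewrite divr_gt0 // ltr_wpDl.
have e20 : 0 < (e / (rnorm c + 1)) / 2 by rewrite divr_gt0.
have f0 : 0 < e / 2 by rewrite divr_gt0.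
have g0 : 0 < e / 2 / (rnorm c + 1) by rewrite divr_gt0 // ltr_wpDl.
have [N1 h1] := cu _ g0; have [N2 h2] := cv _ f0.
exists (maxn N1 N2) => m n; rewrite !geq_max => /andP[m1 m2] /andP[n1 n2].
have -> : (c *: u + v) m - (c *: u + v) n = c *: (u m - u n) + (v m - v n).
  by rewrite scalerBr opprD addrACA.
rewrite (le_lt_trans (seminormD _ _ _)) // (splitr e) ler_ltD ?h2 //.
rewrite seminormZ (le_trans (ler_wpM2l nc0 (ltW (h1 _ _ m1 n1)))) //.
rewrite mulrCA ger_pMr // ler_pdivrMr ?ltr_wpDl // mul1r.
by rewrite lerDl.
Qed.
HB.instance Definition _ := GRing.isSubmodClosed.Build R[i] (nat -> V)
  cauchy_seqs cauchy_seqs_submod_closed.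

Record cseq := CSeq { cseq_val :> nat -> V; _ : cseq_val \in cauchy_seqs }.
HB.instance Definition _ := [isSub for cseq_val].
HB.instance Definition _ := [Choice of cseq by <:].
HB.instance Definition _ := [SubChoice_isSubLmodule of cseq by <:].

Lemma cseqP (u : cseq) : cauchy_wrt u.
Proof. by apply/asboolP; case: u. Qed.

Lemma cseqDE (u v : cseq) n : (u + v) n = u n + v n. Proof. by []. Qed.
Lemma cseqNE (u : cseq) n : (- u) n = - u n. Proof. by []. Qed.
Lemma cseqZE c (u : cseq) n : (c *: u) n = c *: u n. Proof. by []. Qed.

Lemma cseq_cvg (u : cseq) : cvgn (p \o u).
Proof.
apply/cauchy_cvgP/cauchy_ballP => e e0; near_simpl.
have [N hN] := cseqP u e0.
exists ([set n | (N <= n)%N], [set n | (N <= n)%N]).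
  by split; exists N.
move=> [m n] /= [Nm Nn]; rewrite /ball /=.
by rewrite (le_lt_trans (seminorm_dist _ _ _)) // hN.
Qed.

Definition null_seqs : {pred cseq} := fun u => `[< p (u n) @[n --> \oo] --> 0 >].

Lemma null_seqs_submod_closed : submod_closed null_seqs.
Proof.
split=> [|c u v /asboolP cu /asboolP cv]; apply/asboolP.
  rewrite (_ : (fun n => _) = cst 0); first exact: cvg_cst.
  by apply/funext => n /=; exact: seminorm0.
apply: (@squeeze_cvgr _ _ _ _ (cst 0) (fun n => rnorm c * p (u n) + p (v n))).
- near=> n; rewrite seminorm_ge0 /= (le_trans (seminormD _ _ _)) //.
  by rewrite seminormZ.
- exact: cvg_cst.
- by rewrite -[0](addr0 0) -[X in X + _](mulr0 (rnorm c));
    apply: cvgD => //; apply: cvgMr.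
Unshelve. all: by end_near. Qed.
HB.instance Definition _ := GRing.isSubmodClosed.Build R[i] cseq
  null_seqs null_seqs_submod_closed.

End CauchySeq.
Arguments null_seqs {R V} p.

(* The completion of a seminormed space: Cauchy sequences modulo null
   sequences, with the limit norm. *)
Section Completion.
Variables (R : realType) (V : lmodType R[i]) (p : seminorm V).

Definition completion : Type := lquot (null_seqs p).
HB.instance Definition _ := GRing.Lmodule.on completion.

Definition cpi (u : cseq p) : completion := qpi (null_seqs p) u.
Lemma cpi_is_linear : linear cpi.
Proof. exact: qpi_is_linear. Qed.
HB.instance Definition _ := GRing.isLinear.Build R[i] (cseq p) completion *:%R
  cpi cpi_is_linear.

Definition cnorm (x : completion) : R := limn (p \o (qrep x : cseq p)).

Lemma cnorm_cvg (u : cseq p) : p (u n) @[n --> \oo] --> cnorm (cpi u).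
Proof.
rewrite /cnorm; set v : cseq p := qrep _.
have /asboolP uv0 : v - u \in null_seqs p by exact: qpi_rep.
have vl := @cseq_cvg _ _ _ v.
rewrite -[limn _]subr0.
apply: (@squeeze_cvgr _ _ _ _ (fun n => p (v n) - p ((v - u) n))
                              (fun n => p (v n) + p ((v - u) n))).
- near=> n; have := seminorm_dist p (v n) (u n).
  rewrite -[p (v n - u n)]/(p ((v - u) n)) ler_norml lerBlDr => /andP[h1 h2].
  by rewrite lerBlDr addrC -lerBlDr lerBlDl addrC h2 -lerBlDl -lerN2 opprB h1.
- exact: cvgB.
- by rewrite subr0 -[limn _]addr0; exact: cvgD.
Unshelve. all: by end_near. Qed.

Lemma cnormE (u : cseq p) (l : R) :
  p (u n) @[n --> \oo] --> l -> cnorm (cpi u) = l.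
Proof. move=> h; rewrite -(cvg_lim (@Rhausdorff R) h).
exact/esym/(cvg_lim (@Rhausdorff R))/cnorm_cvg. Qed.

Let cpiK x : cpi (qrep x) = x. Proof. exact: qrepK. Qed.

Let cnormD x y : (cnorm (x + y))%:C <= (cnorm x)%:C + (cnorm y)%:C.
Proof.
rewrite -rmorphD lecR -[x]cpiK -[y]cpiK -raddfD.
move: (qrep x) (qrep y) => u v.
apply: (ler_cvg_to (@cnorm_cvg (u + v))
  (cvgD (@cnorm_cvg u) (@cnorm_cvg v))).
by near=> n; exact: seminormD.
Unshelve. all: by end_near. Qed.

Let cnormZ c x : (cnorm (c *: x))%:C = `|c| * (cnorm x)%:C.
Proof.
rewrite rnorm_scalarE -rmorphM /= -[x]cpiK -linearZ /=; congr _%:C.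
apply: cnormE; rewrite (_ : (fun n => _) = (fun n => rnorm c * p (qrep x n))).
  by apply: cvgMr; exact: cnorm_cvg.
by apply/funext => n; rewrite seminormZ.
Qed.

Let cnorm0_eq0 x : (cnorm x)%:C = 0 -> x = 0.
Proof.
move=> /complexI; rewrite -[x]cpiK => h; apply/qpi_eq0/asboolP.
by rewrite -h; exact: cnorm_cvg.
Qed.

HB.instance Definition _ := Lmodule_isNormed.Build R[i] completion
  cnormD cnormZ cnorm0_eq0.

Lemma completion_normE (x : completion) : rnorm x = cnorm x.
Proof. by []. Qed.

Lemma cst_cauchy (v : V) : (fun _ : nat => v) \in cauchy_seqs p.
Proof.
by apply/asboolP => e e0; exists 0 => m n _ _; rewrite subrr seminorm0.
Qed.

Definition cinj (v : V) : completion := cpi (CSeq (cst_cauchy v)).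

Lemma cinj_is_linear : linear cinj.
Proof. move=> c x y; rewrite /cinj -(linearP cpi); congr (cpi _).
by apply: val_inj; apply/funext. Qed.
HB.instance Definition _ := GRing.isLinear.Build R[i] V completion *:%R
  cinj cinj_is_linear.

Lemma cinj_norm (v : V) : rnorm (cinj v) = p v.
Proof.
rewrite completion_normE; apply: (@cnormE (CSeq (cst_cauchy v))).
exact: (cvg_cst (p v)).
Qed.

Lemma cinj_cvg (u : cseq p) (e : R) : 0 < e ->
  exists N, forall n, (N <= n)%N -> rnorm (cpi u - cinj (u n)) <= e.
Proof.
move=> e0; have [N hN] := cseqP u e0; exists N => n Nn.
rewrite -raddfB completion_normE.
have h := @cnorm_cvg (u - CSeq (cst_cauchy (u n))).
apply: (ler_cvg_to h (cvg_cst e)).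
by exists N => // m /= Nm; apply: ltW; exact: hN.
Qed.

Lemma cinj_dense (x : completion) (e : R) : 0 < e ->
  exists v, rnorm (x - cinj v) <= e.
Proof.
move=> e0; rewrite -[x]cpiK; have [N hN] := cinj_cvg (qrep x) e0.
by exists (qrep x N); exact: hN.
Qed.

Lemma completion_complete (F : set_system completion) :
  ProperFilter F -> cauchy F -> cvg F.
Proof.
move=> FF cF; have Fc := (cauchyP F).1 cF.
have sn0 n : 0 < (n.+1%:R^-1 : R) by rewrite invr_gt0.
have pick n : exists v : V, F [set y | rnorm (y - cinj v) < n.+1%:R^-1].
  have e0 : 0 < (n.+1%:R^-1 / 2 : R) by rewrite divr_gt0.
  have e1 : 0 < (n.+1%:R^-1 / 2)%:C :> R[i] by rewrite ltcR.
  have [x Fx] := Fc FF _ e1.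
  have [v xv] := cinj_dense x e0.
  exists v; apply: filterS Fx => y; rewrite -ball_normE /= rnormE ltcR => xy.
  rewrite -(subrK x y) -addrA (le_lt_trans (rnormD _ _)) //.
  by rewrite (splitr (_^-1)) ltr_leD // -rnormN opprB.
have {pick} [v Fv] := choice pick.
have vv m n : p (v m - v n) < m.+1%:R^-1 + n.+1%:R^-1.
  have [y [ym yn]] := @filter_ex _ F _ _ (filterI (Fv m) (Fv n)).
  rewrite -cinj_norm (raddfB cinj) /= -[X in X - _](subrK y) -addrA.
  by rewrite (le_lt_trans (rnormD _ _)) // ltrD // -rnormN opprB.
have cv : v \in cauchy_seqs p.
  apply/asboolP => e e0.
  have e20 : 0 < e / 2 by rewrite divr_gt0.
  have [N _ hN] : \forall n \near \oo, (n.+1%:R^-1 : R) < e / 2.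
    by near=> n; near: n; exact: near_infty_natSinv_lt (PosNum e20).
  exists N => m n Nm Nn; rewrite (lt_trans (vv m n)) // (splitr e).
  by rewrite ltrD ?hN.
apply/cvg_ex; exists (cpi (CSeq cv)); apply/cvgrPdist_lt => e e0.
have e0' : 0 < complex.Re e by rewrite -ltcR RRe_real // gtr0_real.
have e20 : 0 < complex.Re e / 2 by rewrite divr_gt0.
have [N1 h1] := cinj_cvg (CSeq cv) e20.
have [N2 _ h2] : \forall n \near \oo, (n.+1%:R^-1 : R) < complex.Re e / 2.
  by near=> n; near: n; exact: near_infty_natSinv_lt (PosNum e20).
set N := maxn N1 N2.
apply: filterS (Fv N) => y yN.
rewrite rnormE -[e]RRe_real ?gtr0_real // ltcR.
rewrite -(subrK (cinj (v N)) (cpi _)) -addrA (le_lt_trans (rnormD _ _)) //.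
rewrite (splitr (complex.Re e)) ler_ltD ?h1 ?leq_maxl //.
by rewrite -rnormN opprB (lt_trans yN) // h2 //= leq_maxr.
Unshelve. all: by end_near. Qed.

HB.instance Definition _ := Uniform_isComplete.Build completion
  completion_complete.

End Completion.

Section NormSeminorm.
Variables (R : realType) (V : normedModType R[i]).

Definition rnorm_seminorm : seminorm V :=
  Seminorm (@rnormD R V) (@rnormZ R V).

Lemma cvg_rnormP (u : nat -> V) (l : V) :
  u @ \oo --> l <-> rnorm (l - u n) @[n --> \oo] --> 0.
Proof.
split=> [/cvgrPdist_lt h|/cvgrPdist_lt h]; apply/cvgrPdist_lt => e e0.
  have e0' : 0 < e%:C :> R[i] by rewrite ltcR.
  near=> n; rewrite sub0r normrN ger0_norm ?rnorm_ge0 // -ltcR -rnormE.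
  by near: n; exact: h.
have e0' : 0 < complex.Re e by rewrite -ltcR RRe_real // gtr0_real.
near=> n; rewrite rnormE -[e]RRe_real ?gtr0_real // ltcR.
rewrite -[ltLHS]ger0_norm ?rnorm_ge0 // -normrN -sub0r.
by near: n; exact: h.
Unshelve. all: by end_near. Qed.

Lemma cvg_rnorm (u : nat -> V) (l : V) :
  u @ \oo --> l -> rnorm (u n) @[n --> \oo] --> rnorm l.
Proof.
move=> /cvg_rnormP h; apply/cvgrPdist_lt => e e0.
move/cvgrPdist_lt: h => /(_ e e0) h.
near=> n; rewrite (le_lt_trans (seminorm_dist rnorm_seminorm _ _)) //=.
rewrite -[ltLHS]ger0_norm ?rnorm_ge0 // -normrN -sub0r.
by near: n; exact: h.
Unshelve. all: by end_near. Qed.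

End NormSeminorm.

Section CompletionExt.
Variables (R : realType) (V : lmodType R[i]) (p : seminorm V).
Variables (Z : completeNormedModType R[i]) (L0 : V -> Z) (M : R).
Hypothesis L0_linear : linear L0.
Hypothesis L0_bound : forall v, rnorm (L0 v) <= M * p v.

HB.instance Definition _ := GRing.isLinear.Build R[i] V Z *:%R L0 L0_linear.

Let L0_cvg (u : cseq p) : cvgn (L0 \o u).
Proof.
apply/cauchy_cvgP/cauchy_ballP => e e0; near_simpl.
have e0' : 0 < complex.Re e by rewrite -ltcR RRe_real // gtr0_real.
have d0 : 0 < complex.Re e / (`|M| + 1) by rewrite divr_gt0 // ltr_wpDl.
have [N hN] := cseqP u d0.
exists ([set n | (N <= n)%N], [set n | (N <= n)%N]).
  by split; exists N.
move=> [m n] /= [Nm Nn]; rewrite -ball_normE /= rnormE -[e]RRe_real ?gtr0_real //.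
rewrite ltcR -raddfB (le_lt_trans (L0_bound _)) //.
have := hN _ _ Nm Nn; rewrite ltr_pdivlMr ?ltr_wpDl // => h.
apply: le_lt_trans h; rewrite mulrC ler_wpM2l ?seminorm_ge0 //.
by rewrite (le_trans (ler_norm M)) // lerDl.
Qed.

Definition completion_ext (x : completion p) : Z :=
  limn (L0 \o (qrep x : cseq p)).

Lemma completion_ext_cvg (u : cseq p) :
  (L0 \o u) @ \oo --> completion_ext (cpi u).
Proof.
rewrite /completion_ext; set v : cseq p := qrep _.
have /asboolP uv0 : v - u \in null_seqs p by exact: qpi_rep.
have vl := @L0_cvg v.
have w0 : L0 ((v - u) n) @[n --> \oo] --> 0.
  apply/cvg_rnormP.
  apply: (@squeeze_cvgr _ _ _ _ (cst 0) (fun n => M * p ((v - u) n))).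
  - by near=> n; rewrite rnorm_ge0 sub0r rnormN L0_bound.
  - exact: cvg_cst.
  - by rewrite -(mulr0 M); exact: cvgMr.
rewrite -[limn _]subr0.
have -> : L0 \o u = (fun n => L0 (v n) - L0 ((v - u) n)).
  by apply/funext => n; rewrite -raddfB /=; congr L0;
     rewrite opprB addrCA subrr addr0.
exact: cvgB.
Unshelve. all: by end_near. Qed.

Let cpiK (x : completion p) : cpi (qrep x) = x. Proof. exact: qrepK. Qed.

Lemma completion_ext_linear : linear completion_ext.
Proof.
move=> c x y; rewrite -[x]cpiK -[y]cpiK -linearP /=.
move: (qrep x) (qrep y) => u v.
have h := @completion_ext_cvg (c *: u + v).
rewrite -[LHS](cvg_lim (@norm_hausdorff _ _) h).
apply: (cvg_lim (@norm_hausdorff _ _)).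
have -> : L0 \o (c *: u + v : cseq p) = (fun n => c *: L0 (u n) + L0 (v n)).
  by apply/funext => n /=; rewrite -linearP.
by apply: cvgD; [apply: cvgZr|]; exact: completion_ext_cvg.
Qed.

Lemma completion_ext_bound x : rnorm (completion_ext x) <= M * rnorm x.
Proof.
rewrite -[x]cpiK; move: (qrep x) => u.
have h1 := cvg_rnorm (@completion_ext_cvg u).
have h2 : M * p (u n) @[n --> \oo] --> M * rnorm (cpi u).
  by rewrite completion_normE; apply: cvgMr; exact: cnorm_cvg.
apply: (ler_cvg_to h1 h2).
by near=> n; exact: L0_bound.
Unshelve. all: by end_near. Qed.

Lemma completion_ext_cinj v : completion_ext (cinj p v) = L0 v.
Proof.
have h := @completion_ext_cvg (CSeq (cst_cauchy p v)).
rewrite -[LHS](cvg_lim (@norm_hausdorff _ _) h).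
exact: (cvg_lim (@norm_hausdorff _ _) (cvg_cst (L0 v))).
Qed.

End CompletionExt.

Lemma completion_ext_unique (R : realType) (V : lmodType R[i]) (p : seminorm V)
    (Z : normedModType R[i]) (L1 L2 : completion p -> Z) (M1 M2 : R) :
  linear L1 -> linear L2 ->
  (forall x, rnorm (L1 x) <= M1 * rnorm x) ->
  (forall x, rnorm (L2 x) <= M2 * rnorm x) ->
  (forall v, L1 (cinj p v) = L2 (cinj p v)) -> L1 =1 L2.
Proof.
move=> l1 l2 b1 b2 e12 x.
pose f1 : {linear _ -> _} := HB.pack L1 (GRing.isLinear.Build _ _ _ *:%R L1 l1).
pose f2 : {linear _ -> _} := HB.pack L2 (GRing.isLinear.Build _ _ _ *:%R L2 l2).
have l1B y z : L1 (y - z) = L1 y - L1 z := raddfB f1 y z.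
have l2B y z : L2 (y - z) = L2 y - L2 z := raddfB f2 y z.
apply/eqP; rewrite -subr_eq0 -normr_eq0 rnormE.
suff -> : rnorm (L1 x - L2 x) = 0 by [].
apply/le_anti; rewrite rnorm_ge0 andbT.
apply/ler_addgt0Pr => e e0; rewrite add0r.
have M0 : 0 < `|M1| + `|M2| + 1 by rewrite ltr_wpDl // addr_ge0.
have d0 : 0 < e / (`|M1| + `|M2| + 1) by rewrite divr_gt0.
have [v hv] := cinj_dense x d0.
have -> : L1 x - L2 x = L1 (x - cinj p v) - L2 (x - cinj p v).
  rewrite l1B l2B e12.
  by rewrite opprD opprK addrACA [- _ + _]addrC subrr addr0.
rewrite (le_trans (rnormD _ _)) // rnormN (le_trans (lerD (b1 _) (b2 _))) //.
rewrite -mulrDl.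
have h : (M1 + M2) <= `|M1| + `|M2| + 1.
  by rewrite (le_trans (lerD (ler_norm _) (ler_norm _))) // lerDl.
rewrite (le_trans (ler_wpM2r (rnorm_ge0 _) h)) // mulrC.
by rewrite -ler_pdivlMr.
Qed.

Section FgLift.
Variables (K : nzRingType) (T : choiceType) (M : lmodType K) (f : T -> M).

Lemma fglift_is_linear : linear (fglift f).
Proof.
have fB := @lift_is_additive K T M f.
pose g : {additive _ -> _} := HB.pack (fglift f)
  (GRing.isZmodMorphism.Build _ _ (fglift f) fB).
have fD x y : fglift f (x + y) = fglift f x + fglift f y := raddfD g x y.
have fS (I : Type) (r : seq I) (F : I -> {freeg T / K}) :
    fglift f (\sum_(i <- r) F i) = \sum_(i <- r) fglift f (F i) :=
  raddf_sum g r predT F.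
move=> c x y; rewrite fD; congr (_ + _).
rewrite -{2}[x]freeg_sumE -[_ *: x]/(fgscale c x) /fgscale !fS scaler_sumr.
by apply: eq_bigr => z _; rewrite !liftU scalerA.
Qed.

End FgLift.

Section AlgebraicTensor.
Variables (K : nzRingType) (X Y : lmodType K).
Local Notation F := {freeg (X * Y) / K}.

Definition tensor_relations : set F :=
  [set w | (exists (c : K) (x x' : X) (y : Y),
      w = << (c *: x + x', y) >> - (c *: << (x, y) >> + << (x', y) >>)) \/
    (exists (c : K) (x : X) (y y' : Y),
      w = << (x, c *: y + y') >> - (c *: << (x, y) >> + << (x, y') >>))].

Definition algtensor : Type := lquot (lspan tensor_relations).
HB.instance Definition _ := GRing.Lmodule.on algtensor.

Definition atens (x : X) (y : Y) : algtensor :=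
  qpi (lspan tensor_relations) (<< (x, y) >> : F).

Lemma atens_bilinear : bilinear_for *:%R *:%R atens.
Proof.
split=> [y c x x'|x c y y'] /=; rewrite /atens -linearP; apply/qpi_eq;
  apply: lspan_gen; [left|right].
- by exists c, x, x', y.
- by exists c, x, y, y'.
Qed.

Lemma atens_span (t : algtensor) :
  exists s : seq (X * Y), \sum_(z <- s) atens z.1 z.2 = t.
Proof.
rewrite -[t]qrepK; set w := qrep t.
exists [seq (coeff z w *: z.1, z.2) | z <- dom w].
rewrite big_map -[in RHS](freeg_sumE w) linear_sum /=; apply: eq_bigr => -[x y] _.
have := atens_bilinear.1 y (coeff (x, y) w) x 0; rewrite addr0 /= => ->.
have -> : atens 0 y = 0.
  have := atens_bilinear.1 y (-1) 0 0.
  by rewrite /= scaler0 addr0 scaleN1r addNr.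
rewrite addr0 /atens -linearZ /=; congr (qpi _ _).
by apply/eqP/freeg_eqP => z; rewrite coeffZ !coeffU mul1r.
Qed.

Variables (Z : lmodType K) (B : X -> Y -> Z).
Hypothesis B_bilinear : bilinear_for *:%R *:%R B.

Definition atens_lift (t : algtensor) : Z :=
  fglift (fun z : X * Y => B z.1 z.2) (qrep t).

Let g := fglift (fun z : X * Y => B z.1 z.2).
HB.instance Definition _ := GRing.isLinear.Build K F Z *:%R g
  (fglift_is_linear _).

Let g_rel w : w \in lspan tensor_relations -> g w = 0.
Proof.
move=> /(@lspan_min _ _ _ (fun w => `[< g w = 0 >])) h; apply/asboolP/h.
  split=> [|c x y /asboolP gx /asboolP gy]; apply/asboolP.
    exact: raddf0.
  by rewrite linearP /= [g x]gx [g y]gy scaler0 addr0.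
move=> y [[c [x [x' [z ->]]]]|[c [x [z [z' ->]]]]]; apply/asboolP;
  rewrite raddfB /= linearP /= ![g _]liftU !scale1r /=.
- by rewrite B_bilinear.1 subrr.
- by rewrite B_bilinear.2 subrr.
Qed.

Lemma atens_lift_pi w : atens_lift (qpi (lspan tensor_relations) w) = g w.
Proof.
have := g_rel (qpi_rep (lspan tensor_relations) w).
by rewrite (raddfB g) => /eqP; rewrite subr_eq0 => /eqP.
Qed.

Lemma atens_lift_linear : linear atens_lift.
Proof.
move=> c x y; rewrite -[x]qrepK -[y]qrepK -linearP !atens_lift_pi.
exact: linearP.
Qed.

Lemma atens_liftE x y : atens_lift (atens x y) = B x y.
Proof. by rewrite /atens atens_lift_pi /g liftU scale1r. Qed.

End AlgebraicTensor.

Section ProjectiveTensor.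
Variables (R : realType) (X Y : normedModType R[i]).

Definition tensor_sum (s : seq (X * Y)) : algtensor X Y :=
  \sum_(z <- s) atens z.1 z.2.
Definition tensor_cost (s : seq (X * Y)) : R :=
  \sum_(z <- s) rnorm z.1 * rnorm z.2.

(* pi(t) = inf { \sum_i |x_i| |y_i| : t = \sum_i x_i (x) y_i } *)
Definition proj_norm : algtensor X Y -> R := gauge tensor_cost tensor_sum.

Let cost_ge0 s : 0 <= tensor_cost s.
Proof. by apply: sumr_ge0 => z _; rewrite mulr_ge0 ?rnorm_ge0. Qed.

Let tens_surj t : exists s, tensor_sum s = t.
Proof. exact: atens_span. Qed.

Let proj_normD s t : proj_norm (s + t) <= proj_norm s + proj_norm t.
Proof.
apply: (@gaugeD _ _ _ _ _ cat) => // u v.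
- exact: big_cat.
- by rewrite /tensor_cost big_cat.
Qed.

Let proj_normZ (c : R[i]) t : proj_norm (c *: t) = rnorm c * proj_norm t.
Proof.
apply: (@gaugeZ _ _ _ _ _ (fun c => map (fun z => (c *: z.1, z.2)))) => // a u.
- rewrite /tensor_sum big_map scaler_sumr; apply: eq_bigr => -[x y] _ /=.
  have := (atens_bilinear X Y).1 y a x 0; rewrite addr0 /= => ->.
  have -> : atens 0 y = 0 :> algtensor X Y.
    have := (atens_bilinear X Y).1 y (-1) 0 0.
    by rewrite /= scaler0 addr0 scaleN1r addNr.
  by rewrite addr0.
- rewrite /tensor_cost big_map mulr_sumr; apply: ler_sum => -[x y] _ /=.
  by rewrite rnormZ mulrA.
Qed.

Definition proj_seminorm : seminorm (algtensor X Y) :=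
  Seminorm proj_normD proj_normZ.

Definition ptensor : Type := completion proj_seminorm.
HB.instance Definition _ := CompleteNormedModule.on ptensor.

Definition tens (x : X) (y : Y) : ptensor := cinj proj_seminorm (atens x y).

Lemma tens_bilinear : bilinear_for *:%R *:%R tens.
Proof.
split=> [y c x x'|x c y y'] /=; rewrite /tens -linearP; congr (cinj _ _).
- exact: (atens_bilinear X Y).1.
- exact: (atens_bilinear X Y).2.
Qed.

Lemma tens_norm x y : rnorm (tens x y) <= rnorm x * rnorm y.
Proof.
rewrite cinj_norm -[atens x y](_ : tensor_sum [:: (x, y)] = _).
  rewrite (le_trans (gauge_le _ _ _)) //.
  by rewrite /tensor_cost big_seq1.
by rewrite /tensor_sum big_seq1.
Qed.

Lemma ptensor_ext (Z : normedModType R[i]) (L1 L2 : ptensor -> Z) (M1 M2 : R) :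
  linear L1 -> linear L2 ->
  (forall t, rnorm (L1 t) <= M1 * rnorm t) ->
  (forall t, rnorm (L2 t) <= M2 * rnorm t) ->
  (forall x y, L1 (tens x y) = L2 (tens x y)) -> L1 =1 L2.
Proof.
move=> l1 l2 b1 b2 e12; apply: (completion_ext_unique l1 l2 b1 b2) => v.
pose f1 : {linear _ -> _} := HB.pack L1 (GRing.isLinear.Build _ _ _ *:%R L1 l1).
pose f2 : {linear _ -> _} := HB.pack L2 (GRing.isLinear.Build _ _ _ *:%R L2 l2).
have [s <-] := atens_span v; rewrite raddf_sum /=.
transitivity (\sum_(z <- s) L1 (tens z.1 z.2)).
  exact: (raddf_sum f1).
rewrite (eq_bigr _ (fun z _ => e12 z.1 z.2)).
exact/esym/(raddf_sum f2).
Qed.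

Lemma ptensor_univ (Z : completeNormedModType R[i]) (B : X -> Y -> Z) (M : R) :
  bilinear_for *:%R *:%R B ->
  (forall x y, rnorm (B x y) <= M * (rnorm x * rnorm y)) ->
  exists L : ptensor -> Z, [/\ linear L, forall t, rnorm (L t) <= M * rnorm t
    & forall x y, L (tens x y) = B x y].
Proof.
move=> Bl Bb; have L0l := atens_lift_linear Bl.
pose f : {linear _ -> _} := HB.pack (atens_lift B)
  (GRing.isLinear.Build _ _ _ *:%R (atens_lift B) L0l).
have sB s : rnorm (atens_lift B (tensor_sum s)) <= M * tensor_cost s.
  rewrite /tensor_cost mulr_sumr -[atens_lift B _]/(f _) raddf_sum /=.
  elim/big_rec2: _ => [|z a b _ h]; first by rewrite rnorm0.
  rewrite (le_trans (rnormD _ _)) // lerD //.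
  by rewrite atens_liftE.
have L0b v : rnorm (atens_lift B v) <= M * proj_seminorm v.
  have [M0|M0] := leP 0 M.
    apply/ler_addgt0Pr => e e0.
    have d0 : 0 < e / (M + 1) by rewrite divr_gt0 // ltr_wpDl.
    have [s <- h] := @gauge_lt _ _ _ tensor_cost tensor_sum cost_ge0 tens_surj
      v _ d0.
    rewrite (le_trans (sB s)) // (le_trans (ler_wpM2l M0 (ltW h))) //.
    rewrite mulrDr lerD2l mulrCA ger_pMr // ler_pdivrMr ?ltr_wpDl // mul1r.
    by rewrite lerDl.
  have [s <-] := tens_surj v.
  rewrite (le_trans (sB s)) // (ler_wnM2l (ltW M0)) //.
  by apply: (@gauge_le _ _ _ tensor_cost tensor_sum).
exists (completion_ext (atens_lift B)); split.
- exact: (completion_ext_linear L0l L0b).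
- exact: (completion_ext_bound L0l L0b).
- by move=> x y; rewrite /tens (completion_ext_cinj L0l L0b) atens_liftE.
Qed.

End ProjectiveTensor.
Arguments tens {R X Y} x y.

Definition bounded_map (R : realType) (X Y : normedModType R[i]) (f : X -> Y) :=
  exists M : R, forall x, rnorm (f x) <= M * rnorm x.

Definition bounded_bilinear (R : realType) (X Y Z : normedModType R[i])
    (B : X -> Y -> Z) :=
  bilinear_for *:%R *:%R B /\
  exists M : R, forall x y, rnorm (B x y) <= M * (rnorm x * rnorm y).

Section BoundedLinear.
Variable R : realType.
Implicit Types X Y Z : normedModType R[i].

Definition bounded_linear X Y (f : X -> Y) := linear f /\ bounded_map f.

Lemma bounded_linear_id X : bounded_linear (@id X).
Proof. by split=> //; exists 1 => x; rewrite mul1r. Qed.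

Lemma bounded_linear_comp X Y Z (f : Y -> Z) (g : X -> Y) :
  bounded_linear f -> bounded_linear g -> bounded_linear (fun x => f (g x)).
Proof.
move=> [fl [M fM]] [gl [N gN]]; split=> [c x y|]; first by rewrite gl fl.
exists (`|M| * N) => x; rewrite (le_trans (fM _)) // -mulrA.
rewrite (le_trans (ler_wpM2r (rnorm_ge0 _) (ler_norm M))) //.
by rewrite ler_wpM2l.
Qed.

Lemma bounded_linearD X Y (c : R[i]) (f g : X -> Y) :
  bounded_linear f -> bounded_linear g ->
  bounded_linear (fun x => c *: f x + g x).
Proof.
move=> [fl [M fM]] [gl [N gN]]; split=> [d x y|].
  by rewrite fl gl !scalerDr addrACA !scalerA mulrC.
exists (rnorm c * M + N) => x; rewrite (le_trans (rnormD _ _)) // mulrDl.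
rewrite lerD // rnormZ -mulrA ler_wpM2l //.
by rewrite -ler0c -rnorm_scalarE.
Qed.

End BoundedLinear.

Section TensorLift.
Variables (R : realType) (X Y : normedModType R[i]).

Lemma ptensor_eq (Z : normedModType R[i]) (L1 L2 : ptensor X Y -> Z) :
  bounded_linear L1 -> bounded_linear L2 ->
  (forall x y, L1 (tens x y) = L2 (tens x y)) -> L1 =1 L2.
Proof. by move=> [l1 [M1 b1]] [l2 [M2 b2]]; exact: ptensor_ext l1 l2 b1 b2. Qed.

Variable Z : completeNormedModType R[i].
Implicit Type B : X -> Y -> Z.

(* The bounded linear map sending x (x) y to B x y; it exists and is unique when
   B is bounded bilinear (see tliftP and ptensor_eq). *)
Definition tlift B : ptensor X Y -> Z :=
  xget (fun=> 0) [set L | bounded_linear L /\ forall x y, L (tens x y) = B x y].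

Lemma tliftP B : bounded_bilinear B ->
  bounded_linear (tlift B) /\ forall x y, tlift B (tens x y) = B x y.
Proof.
move=> [Bl [M BM]]; have [L [Ll LM LB]] := ptensor_univ Bl BM.
have h : [set L | bounded_linear L /\ forall x y, L (tens x y) = B x y] L.
  by split=> //; split=> //; exists M.
exact: (xgetPex (fun=> 0) (ex_intro _ L h)).
Qed.

Lemma tlift_bound B (M : R) : bilinear_for *:%R *:%R B ->
  (forall x y, rnorm (B x y) <= M * (rnorm x * rnorm y)) ->
  forall t, rnorm (tlift B t) <= M * rnorm t.
Proof.
move=> Bl BM t; have [L [Ll LM LB]] := ptensor_univ Bl BM.
have [bl e] : bounded_linear (tlift B) /\ forall x y, tlift B (tens x y) = B x y.
  by apply: tliftP; split=> //; exists M.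
rewrite (@ptensor_eq _ _ L) //; first by split=> //; exists M.
by move=> x y; rewrite e LB.
Qed.

End TensorLift.

HB.mixin Record CompleteNormedModule_isBanachAlgebra (R : realType) A
    & CompleteNormedModule R[i] A := {
  bmul : A -> A -> A;
  bmulA : associative bmul;
  bmul_bilinear : bilinear_for *:%R *:%R bmul;
  bmul_norm : forall a b, `|bmul a b| <= `|a| * `|b|
}.

(* Complex Banach algebras, not necessarily unital. *)
#[short(type="banachAlgType")]
HB.structure Definition BanachAlgebra (R : realType) :=
  {A of CompleteNormedModule_isBanachAlgebra R A & CompleteNormedModule R[i] A}.

Notation "a ** b" := (bmul a b) (at level 40, left associativity) : ring_scope.

Lemma bmul_rnorm (R : realType) (A : banachAlgType R) (a b : A) :
  rnorm (a ** b) <= rnorm a * rnorm b.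
Proof. by rewrite -lecR rmorphM /= -!rnormE bmul_norm. Qed.

Section TensorAlgebra.
Variables (R : realType) (A : banachAlgType R).
Local Notation T := (ptensor A A).
Implicit Types (a b c d : A) (s t u : T).

Definition tens_mull a b : T -> T := tlift (fun c d => tens (a ** c) (b ** d)).

Let mull_bil a b : bilinear_for *:%R *:%R (fun c d => tens (a ** c) (b ** d)).
Proof.
by split=> [d k c c'|c k d d'] /=; rewrite (bmul_bilinear.2 _)
  1?(tens_bilinear A A).1 1?(tens_bilinear A A).2.
Qed.

Let mull_bnd a b c d :
  rnorm (tens (a ** c) (b ** d)) <= rnorm a * rnorm b * (rnorm c * rnorm d).
Proof.
rewrite (le_trans (tens_norm _ _)) // mulrACA.
by rewrite ler_pM ?rnorm_ge0 ?bmul_rnorm.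
Qed.

Let mull_bl a b : bounded_linear (tens_mull a b).
Proof.
by have [] := @tliftP _ _ _ _ (fun c d => tens (a ** c) (b ** d))
  (conj (mull_bil a b) (ex_intro _ _ (mull_bnd a b))).
Qed.

Let mullE a b c d : tens_mull a b (tens c d) = tens (a ** c) (b ** d).
Proof.
have [_ h] := @tliftP _ _ _ _ (fun c d => tens (a ** c) (b ** d))
  (conj (mull_bil a b) (ex_intro _ _ (mull_bnd a b))).
exact: h.
Qed.

Let mull_rnorm a b t : rnorm (tens_mull a b t) <= rnorm t * (rnorm a * rnorm b).
Proof. by rewrite mulrC; exact: (tlift_bound (mull_bil a b) (mull_bnd a b)). Qed.

Let mull_bilinear t : bilinear_for *:%R *:%R (fun a b => tens_mull a b t).
Proof.
split=> [b k a a'|a k b b'] /=; move: t; apply: ptensor_eq => //;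
  try exact: bounded_linearD; move=> c d; rewrite !mullE (bmul_bilinear.1 _).
- exact: (tens_bilinear A A).1.
- exact: (tens_bilinear A A).2.
Qed.

(* The product of A (x)^ A: (a (x) b) (c (x) d) = ac (x) bd, see pmulE. *)
Definition pmul s t : T := tlift (fun a b => tens_mull a b t) s.

Let mull_bb t : bounded_bilinear (fun a b => tens_mull a b t).
Proof. by split=> //; exists (rnorm t) => a b; exact: mull_rnorm. Qed.

Let pmul_l t : bounded_linear (pmul^~ t).
Proof.
by have [] := tliftP (mull_bb t).
Qed.

Let pmul_tens a b t : pmul (tens a b) t = tens_mull a b t.
Proof.
by have [_ h] := tliftP (mull_bb t); exact: h.
Qed.

Lemma pmulE a b c d : pmul (tens a b) (tens c d) = tens (a ** c) (b ** d).
Proof. by rewrite pmul_tens mullE. Qed.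

Let pmul_rnorm s t : rnorm (pmul s t) <= rnorm t * rnorm s.
Proof.
exact: (tlift_bound (mull_bilinear t) (fun a b => mull_rnorm a b t)).
Qed.

Let pmul_bilinear : bilinear_for *:%R *:%R pmul.
Proof.
split=> [t|s k t t'] /=; first by have [] := pmul_l t.
move: s; apply: ptensor_eq; first exact: pmul_l.
  by apply: bounded_linearD; exact: pmul_l.
by move=> a b; rewrite !pmul_tens; have [h _] := mull_bl a b; rewrite h.
Qed.

Let pmul_r s : bounded_linear (pmul s).
Proof.
split; first by move=> k t t'; rewrite pmul_bilinear.2.
by exists (rnorm s) => t; rewrite mulrC pmul_rnorm.
Qed.

Let pmulA : associative pmul.
Proof.
move=> s t u; move: s; apply: ptensor_eq.
- exact: pmul_l.
- by apply: (@bounded_linear_comp _ _ _ _ (pmul^~ u) (pmul^~ t)); exact: pmul_l.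
move=> a b; rewrite !pmul_tens; move: t; apply: ptensor_eq.
- by apply: (@bounded_linear_comp _ _ _ _ (tens_mull a b) (pmul^~ u)).
- by apply: (@bounded_linear_comp _ _ _ _ (pmul^~ u) (tens_mull a b)).
move=> c d; rewrite mullE !pmul_tens; move: u; apply: ptensor_eq.
- exact: bounded_linear_comp.
- exact: mull_bl.
by move=> e f; rewrite !mullE !bmulA.
Qed.

Let pmul_norm s t : `|pmul s t| <= `|s| * `|t|.
Proof. by rewrite !rnormE -rmorphM lecR mulrC pmul_rnorm. Qed.

HB.instance Definition _ := CompleteNormedModule_isBanachAlgebra.Build R
  (ptensor A A) pmulA pmul_bilinear pmul_norm.

End TensorAlgebra.

Section ClosedIdeals.
Variables (R : realType) (A : banachAlgType R).

Definition closed_ideal (I : {pred A}) : Prop :=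
  [/\ submod_closed I, closed [set x | x \in I] &
      forall a x, x \in I -> a ** x \in I /\ x ** a \in I].

Variable S : set A.

Definition ideal_gen : {pred A} := fun x =>
  `[< forall I : {pred A}, closed_ideal I -> (forall y, S y -> y \in I) ->
      x \in I >].

Lemma ideal_gen_sub x : S x -> x \in ideal_gen.
Proof. by move=> Sx; apply/asboolP => I _; exact. Qed.

Lemma ideal_gen_min (I : {pred A}) : closed_ideal I ->
  (forall y, S y -> y \in I) -> {subset ideal_gen <= I}.
Proof. by move=> Ic SI x /asboolP; exact. Qed.

Lemma ideal_gen_closed_ideal : closed_ideal ideal_gen.
Proof.
split.
- split=> [|c x y /asboolP hx /asboolP hy]; apply/asboolP => I Ic SI.
    by case: (Ic) => -[].
  by case: (Ic) => -[_ h] _ _; apply: h; [exact: hx|exact: hy].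
- move=> x xcl; apply/asboolP => I Ic SI.
  case: (Ic) => _ Icl _; apply: Icl => B nB.
  have [y [yI By]] := xcl B nB; exists y; split=> //=.
  exact: (ideal_gen_min Ic SI).
- move=> a x /asboolP hx; split; apply/asboolP => I Ic SI;
    by case: (Ic) => _ _ /(_ a x (hx I Ic SI)) [].
Qed.

Lemma ideal_gen_submod_closed : submod_closed ideal_gen.
Proof. by case: ideal_gen_closed_ideal. Qed.
Lemma ideal_gen_closed : closed [set x | ideal_gen x].
Proof. by case: ideal_gen_closed_ideal. Qed.
HB.instance Definition _ := GRing.isSubmodClosed.Build R[i] A ideal_gen
  ideal_gen_submod_closed.
HB.instance Definition _ := isClosedPred.Build R[i] A ideal_gen
  ideal_gen_closed.

End ClosedIdeals.

Section QuotientProduct.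
Variables (R : realType) (A : banachAlgType R) (S : closedSubspace A).

(* The product of A/S; it is well defined when S is an ideal, see qmulE. *)
Definition qmul (x y : nquot S) : nquot S := npi S (qrep x ** qrep y).

Lemma qmulE a b : closed_ideal S -> qmul (npi S a) (npi S b) = npi S (a ** b).
Proof.
move=> [[_ lin] _ mul].
apply/npi_eq; set a' := qrep _; set b' := qrep _.
have ha : a' - a \in S by exact: qpi_rep.
have hb : b' - b \in S by exact: qpi_rep.
have -> : a' ** b' - a ** b = 1 *: ((a' - a) ** b') + a ** (b' - b).
  have l1 := (@bmul_bilinear R A).1; have l2 := (@bmul_bilinear R A).2.
  have -> : (a' - a) ** b' = a' ** b' - a ** b'.
    by rewrite [a' - a]addrC -scaleN1r l1 /= scaleN1r addrC.
  have -> : a ** (b' - b) = a ** b' - a ** b.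
    by rewrite [b' - b]addrC -scaleN1r l2 /= scaleN1r addrC.
  by rewrite scale1r addrA subrK.
by apply: lin; [case: (mul b' _ ha)|case: (mul a _ hb)].
Qed.

Definition has_left_identity : Prop := exists e : nquot S, left_id e qmul.

End QuotientProduct.

(* A Banach U-bimodule structure on A whose actions are compatible with the
   product of A. *)
Record compat_bimodule (R : realType) (U A : banachAlgType R) := CompatBimodule {
  lact : U -> A -> A;
  ract : A -> U -> A;
  lact_bounded : bounded_bilinear lact;
  ract_bounded : bounded_bilinear ract;
  lactA : forall al be a, lact (al ** be) a = lact al (lact be a);
  ractA : forall al be a, ract a (al ** be) = ract (ract a al) be;
  lractA : forall al be a, lact al (ract a be) = ract (lact al a) be;
  lact_mul : forall al a b, lact al (a ** b) = lact al a ** b;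
  ract_mul : forall al a b, ract (a ** b) al = a ** ract b al
}.

Section BimoduleActions.
Variables (R : realType) (A : banachAlgType R).
Local Notation T := (ptensor A A).

(* (f (x) g) (b (x) c) = f b (x) g c *)
Definition tens_map (f g : A -> A) : T -> T :=
  tlift (fun b c => tens (f b) (g c)).

Lemma tens_mapP f g : bounded_linear f -> bounded_linear g ->
  bounded_linear (tens_map f g) /\
  forall b c, tens_map f g (tens b c) = tens (f b) (g c).
Proof.
move=> [fl [M fM]] [gl [N gN]]; apply: tliftP; split.
  split=> [c k b b'|b k c c'] /=; first by rewrite fl (tens_bilinear A A).1.
  by rewrite gl (tens_bilinear A A).2.
exists (`|M| * `|N|) => b c; rewrite (le_trans (tens_norm _ _)) // mulrACA.
rewrite ler_pM ?rnorm_ge0 //.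
  by rewrite (le_trans (fM b)) // ler_wpM2r ?rnorm_ge0 ?ler_norm.
by rewrite (le_trans (gN c)) // ler_wpM2r ?rnorm_ge0 ?ler_norm.
Qed.

(* a . (b (x) c) = ab (x) c and (b (x) c) . a = b (x) ca *)
Definition tens_lmul (a : A) : T -> T := tens_map (fun b => a ** b) id.
Definition tens_rmul (t : T) (a : A) : T := tens_map id (fun c => c ** a) t.

(* omega (a (x) b) = ab *)
Definition omega : T -> A := tlift (@bmul R A).

Lemma bmul_bounded_bilinear : bounded_bilinear (@bmul R A).
Proof.
split; first exact: bmul_bilinear.
by exists 1 => a b; rewrite mul1r bmul_rnorm.
Qed.

Lemma omegaP : bounded_linear omega /\ forall a b, omega (tens a b) = a ** b.
Proof. exact: tliftP bmul_bounded_bilinear. Qed.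

Lemma tens_lmulP (a : A) : bounded_linear (tens_lmul a) /\
  forall b c, tens_lmul a (tens b c) = tens (a ** b) c.
Proof.
apply: tens_mapP; last exact: bounded_linear_id.
split; first exact: (@bmul_bilinear R A).2.
by exists (rnorm a) => b; exact: bmul_rnorm.
Qed.

Lemma tens_rmulP (a : A) : bounded_linear (tens_rmul^~ a) /\
  forall b c, tens_rmul (tens b c) a = tens b (c ** a).
Proof.
apply: (tens_mapP (f := id)); first exact: bounded_linear_id.
split; first exact: (@bmul_bilinear R A).1.
by exists (rnorm a) => b; rewrite mulrC; exact: bmul_rnorm.
Qed.

Definition biprojective : Prop :=
  exists rho : A -> T,
    [/\ linear rho, bounded_map rho,
        forall a b, rho (a ** b) = tens_lmul a (rho b),
        forall a b, rho (a ** b) = tens_rmul (rho a) b &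
        forall a, omega (rho a) = a].

End BimoduleActions.

Section ModuleBiprojective.
Variables (R : realType) (U A : banachAlgType R) (M : compat_bimodule U A).
Local Notation T := (ptensor A A).

(* al . (b (x) c) = (al . b) (x) c and (b (x) c) . al = b (x) (c . al) *)
Definition tens_lact (al : U) : T -> T := tens_map (lact M al) id.
Definition tens_ract (t : T) (al : U) : T := tens_map id (fun c => ract M c al) t.

Lemma tens_lactP (al : U) : bounded_linear (tens_lact al) /\
  forall b c, tens_lact al (tens b c) = tens (lact M al b) c.
Proof.
apply: tens_mapP; last exact: bounded_linear_id.
have [bl [N hN]] := lact_bounded M; split; first exact: bl.2.
by exists (N * rnorm al) => b; rewrite -mulrA.
Qed.

Lemma tens_ractP (al : U) : bounded_linear (tens_ract^~ al) /\
  forall b c, tens_ract (tens b c) al = tens b (ract M c al).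
Proof.
apply: (tens_mapP (f := id)); first exact: bounded_linear_id.
have [bl [N hN]] := ract_bounded M; split; first exact: bl.1.
by exists (N * rnorm al) => b; rewrite -mulrA [rnorm al * _]mulrC.
Qed.

Definition left_trivial : Prop :=
  exists2 f : {linear U -> R[i]^o}, continuous f &
    forall al a, lact M al a = f al *: a.

Definition idealI : {pred T} := ideal_gen
  [set t | exists (al : U) (a b : A),
     t = tens (lact M al a) b - tens a (ract M b al)].
HB.instance Definition _ := ClosedSubspace.on idealI.

Lemma idealI_closed_ideal : closed_ideal idealI.
Proof. exact: ideal_gen_closed_ideal. Qed.

Definition idealJ : {pred A} :=
  ideal_gen [set omega t | t in [set t | t \in idealI]].
HB.instance Definition _ := ClosedSubspace.on idealJ.

Lemma idealJ_closed_ideal : closed_ideal idealJ.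
Proof. exact: ideal_gen_closed_ideal. Qed.

Local Notation TI := (nquot idealI).
Local Notation AJ := (nquot idealJ).

Definition omega_tilde (x : TI) : AJ := npi idealJ (omega (qrep x)).

Lemma omega_tildeE t : omega_tilde (npi idealI t) = npi idealJ (omega t).
Proof.
have [[wl _] _] := omegaP A.
pose w : {linear _ -> _} := HB.pack (@omega R A)
  (GRing.isLinear.Build _ _ _ *:%R (@omega R A) wl).
apply/npi_eq; rewrite -[_ - _](raddfB w); apply: ideal_gen_sub.
by exists (qrep (npi idealI t) - t) => //; exact: qpi_rep.
Qed.

(* phi commutes with the maps induced on A/J by f and on (A (x)^ A)/I by g.
   Written on representatives, so as not to presuppose that f preserves J and
   g preserves I. *)
Definition intertwines (phi : AJ -> TI) (f : A -> A) (g : T -> T) : Prop :=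
  forall a t, phi (npi idealJ a) = npi idealI t ->
    phi (npi idealJ (f a)) = npi idealI (g t).

(* The A/J-U-module morphisms from A/J to (A (x)^ A)/I. *)
Definition module_morphism (phi : AJ -> TI) : Prop :=
  [/\ continuous phi,
      {morph phi : x y / x + y},
      forall al, intertwines phi (lact M al) (tens_lact al) /\
        intertwines phi ((ract M)^~ al) (tens_ract^~ al) &
      forall a, intertwines phi (bmul a) (tens_lmul a) /\
        intertwines phi ((@bmul R A)^~ a) (@tens_rmul R A ^~ a)].

Definition module_biprojective : Prop :=
  exists phi : AJ -> TI,
    [/\ bounded_map phi, module_morphism phi &
        forall x, omega_tilde (phi x) = x].

End ModuleBiprojective.

(* Main.v *)
Require Import Defs.
From HB Require Import structures.
From mathcomp Require Import all_boot all_order all_algebra.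
From mathcomp Require Import all_classical all_reals.
From mathcomp Require Import topology normedtype.
From mathcomp Require Import complex.

(** Let rho be a bounded A-bimodule right inverse of omega and let f be the
    functional through which U acts on the left.  The map rho itself descends
    to a module morphism A/J -> (A (x) A)/I, and this is the required right
    inverse of omega_tilde.

    Put d(al, b) = f(al) b - b . al, called [act_defect] below.  By
    compatibility d(al, ab) = a d(al, b), and since U acts on the left through
    f, the ideal I is generated by the tensors a (x) d(al, b).

    The ideal I is stable under both actions of A on A (x) A.  On the left this
    holds because c . (a (x) d) = ca (x) d is again a generator.  On the right
    one needs a (x) dc to lie in I; if a = pq, it is the product
    (p (x) d)(q (x) c), and the general case follows because products span a
    dense subspace of A, a consequence of omega o rho = id
    ([idealI_rmul]).

    The map rho sends J into I ([rho_idealJ]).  Indeed the elements a with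
    rho(a) in I form a closed ideal N, by the previous paragraph.  It contains
    every product a d(al, b), since rho(a d) = rho(a) . d and
    (p (x) q) . d(al, b) = p (x) d(al, qb) is a generator of I.  It remains to
    pass from the generators of I to all of I, which is not immediate because
    omega need not be multiplicative when A is not commutative.  The remedy is the
    family of maps p (x) q |-> pmq with m in A or m absent: the tensors that
    all of them send into N form a closed ideal ([omega_mid_ideal]), which
    contains the generators, hence I.

    Finally, the induced map commutes with U.  On the left both actions are
    multiplication by f(al).  On the right t . al = f(al) t modulo I, by the
    definition of I, and a . al = f(al) a modulo J: if e is a left identity
    modulo J, then d(al, a) is congruent to e d(al, a), which is omega of a
    generator of I ([act_defect_idealJ]). *)

Set Implicit Arguments.
Unset Strict Implicit.
Unset Printing Implicit Defensive.

Import Order.TTheory GRing.Theory Num.Theory.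
Import numFieldNormedType.Exports.

Local Open Scope classical_set_scope.
Local Open Scope ring_scope.
Local Open Scope complex_scope.

(** * Bounded linear maps and closed subspaces *)

Section BoundedLinear.
Variables (R : realType) (V W : normedModType R[i]) (f : V -> W).
Hypothesis fP : bounded_linear f.

Lemma bounded_linear0 : f 0 = 0.
Proof.
case: fP => fl _.
by have := fl (-1) 0 0; rewrite scaler0 addr0 scaleN1r addNr.
Qed.

Lemma bounded_linearB x y : f (x - y) = f x - f y.
Proof.
by case: fP => fl _; rewrite addrC -scaleN1r fl scaleN1r addrC.
Qed.

Lemma bounded_linearZ c x : f (c *: x) = c *: f x.
Proof.
by case: fP => fl _; rewrite -[c *: x]addr0 fl bounded_linear0 addr0.
Qed.

Lemma bounded_linear_continuous : continuous f.
Proof.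
case: fP => _ [M fM] x; apply/cvgrPdist_lt => e e0.
have e0' : 0 < complex.Re e by rewrite -ltcR RRe_real // gtr0_real.
have d0 : 0 < complex.Re e / (`|M| + 1) by rewrite divr_gt0 // ltr_wpDl.
have dc0 : 0 < (complex.Re e / (`|M| + 1))%:C :> R[i] by rewrite ltcR.
near=> y; rewrite -bounded_linearB rnormE -[e]RRe_real ?gtr0_real // ltcR.
rewrite (le_lt_trans (fM _)) //.
have : rnorm (x - y) < complex.Re e / (`|M| + 1).
  rewrite -ltcR -rnormE; near: y; exact: cvgr_dist_lt.
rewrite ltr_pdivlMr ?ltr_wpDl // => h; apply: le_lt_trans h.
rewrite mulrC ler_wpM2l ?rnorm_ge0 //.
by rewrite (le_trans (ler_norm M)) // lerDl.
Unshelve. all: by end_near. Qed.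

End BoundedLinear.

Lemma bounded_linear_scale (R : realType) (V : normedModType R[i]) (c : R[i]) :
  bounded_linear (fun x : V => c *: x).
Proof.
split=> [d x y|]; first by rewrite scalerDr !scalerA mulrC.
by exists (rnorm c) => x; rewrite rnormZ.
Qed.

(** Sending a whole family of maps into S, rather than a single one, is what
    makes the sets of this form into ideals below. *)
Definition preimages (R : realType) (V W : normedModType R[i]) (I : Type)
    (F : I -> V -> W) (S : {pred W}) : {pred V} :=
  fun x => `[< forall i, F i x \in S >].

Section Preimages.
Variables (R : realType) (V W : normedModType R[i]) (I : Type).
Variables (F : I -> V -> W) (S : {pred W}).
Hypothesis FP : forall i, bounded_linear (F i).

Lemma preimages_submod_closed :
  submod_closed S -> submod_closed (preimages F S).
Proof.
move=> [S0 SD]; split=> [|c x y /asboolP hx /asboolP hy]; apply/asboolP => i.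
  by rewrite bounded_linear0.
by have [Fl _] := FP i; rewrite Fl; apply: SD; [exact: hx|exact: hy].
Qed.

Lemma preimages_closed : closed [set x | x \in S] ->
  closed [set x | x \in preimages F S].
Proof.
move=> Scl.
have -> : [set x | x \in preimages F S] =
    \bigcap_i (F i @^-1` [set x | x \in S]).
  apply/seteqP; split=> x /=; first by move=> /asboolP h i _; exact: h.
  by move=> h; apply/asboolP => i; exact: h.
apply: closed_bigI => i _; apply: closed_comp => // x _.
exact: bounded_linear_continuous.
Qed.

End Preimages.

(** Composed with the projection modulo S, the map L vanishes on elementary
    tensors, hence everywhere. *)
Lemma ptensor_in (R : realType) (X Y Z : normedModType R[i])
    (L : ptensor X Y -> Z) (S : closedSubspace Z) :
  bounded_linear L -> (forall x y, L (tens x y) \in S) -> forall t, L t \in S.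
Proof.
move=> LP LS t; apply/qpi_eq0; rewrite -/(npi S (L t)).
have npiP : bounded_linear (npi S).
  split; first exact: linearP.
  by exists 1 => x; rewrite mul1r -lecR -!rnormE npi_norm_le.
have zP : bounded_linear (fun _ : ptensor X Y => 0 : nquot S).
  split=> [c x y|]; first by rewrite scaler0 addr0.
  by exists 0 => x; rewrite rnorm0 mul0r.
apply: (ptensor_eq (bounded_linear_comp npiP LP) zP) => x y.
exact/qpi_eq0/LS.
Qed.

(** * Closed ideals and multipliers *)

Section Multiplication.
Variables (R : realType) (A : banachAlgType R).

Lemma bmul_l (a : A) : bounded_linear (bmul a).
Proof.
split; first exact: (@bmul_bilinear R A).2.
by exists (rnorm a) => b; exact: bmul_rnorm.
Qed.

Lemma bmul_r (a : A) : bounded_linear ((@bmul R A)^~ a).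
Proof.
split; first exact: (@bmul_bilinear R A).1.
by exists (rnorm a) => b; rewrite mulrC; exact: bmul_rnorm.
Qed.

Lemma tens_l (a : A) : bounded_linear (tens a : A -> ptensor A A).
Proof.
split; first exact: (tens_bilinear A A).2.
by exists (rnorm a) => b; exact: tens_norm.
Qed.

Lemma tens_r (a : A) : bounded_linear (fun b : A => tens b a).
Proof.
split; first exact: (tens_bilinear A A).1.
by exists (rnorm a) => b; rewrite mulrC; exact: tens_norm.
Qed.

End Multiplication.

Section Ideals.
Variables (R : realType) (A : banachAlgType R).

(** For a one-sided multiplier g, the elements x such that both x and g x lie
    in the ideal form a closed ideal.  Keeping track of x as well as g x
    matters: if g (x ** y) = g x ** y, then g (x ** y) is in the ideal because
    y is. *)
Lemma ideal_gen_multiplier (S : set A) (g : A -> A) :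
  bounded_linear g ->
  (forall x y, g (x ** y) = g x ** y) \/ (forall x y, g (x ** y) = x ** g y) ->
  (forall x, S x -> g x \in ideal_gen S) ->
  forall x, x \in ideal_gen S -> g x \in ideal_gen S.
Proof.
move=> gP gM gS x xI.
have [Ism Icl Imul] := ideal_gen_closed_ideal S.
pose F (b : bool) := if b then g else id.
have FP b : bounded_linear (F b) by case: b => //; exact: bounded_linear_id.
suff /asboolP/(_ true) : x \in preimages F (ideal_gen S) by [].
apply: (ideal_gen_min _ _ xI) => [|y Sy]; last first.
  by apply/asboolP => -[] /=; [exact: gS|exact: ideal_gen_sub].
split; [exact: preimages_submod_closed|exact: preimages_closed|].
move=> a y /asboolP hy; have yI := hy false; have gyI := hy true.
split; apply/asboolP => -[] /=; try by case: (Imul a y yI).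
  case: gM => ->; first by case: (Imul (g a) y yI).
  by case: (Imul a (g y) gyI).
case: gM => ->; first by case: (Imul a (g y) gyI).
by case: (Imul (g a) y yI).
Qed.

Local Notation T := (ptensor A A).

Lemma closed_ideal_ptensor (K : {pred T}) :
  submod_closed K -> closed [set t | t \in K] ->
  (forall a b t, t \in K -> tens a b ** t \in K /\ t ** tens a b \in K) ->
  closed_ideal K.
Proof.
move=> Ksm Kcl Kmul; split=> // s t tK.
pose S : closedSubspace T := HB.pack K
  (GRing.isSubmodClosed.Build _ _ K Ksm) (isClosedPred.Build _ _ K Kcl).
split.
- apply: (@ptensor_in _ _ _ _ (fun s => s ** t) S) => [|a b].
    exact: (@bmul_r R T).
  by case: (Kmul a b t tK).
- apply: (@ptensor_in _ _ _ _ (fun s => t ** s) S) => [|a b].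
    exact: (@bmul_l R T).
  by case: (Kmul a b t tK).
Qed.

Lemma tens_mul (a b c d : A) :
  (tens a b : T) ** tens c d = tens (a ** c) (b ** d).
Proof. exact: pmulE. Qed.

Lemma tens_lmul_mul a (s t : T) : tens_lmul a (s ** t) = tens_lmul a s ** t.
Proof.
have [lP lE] := tens_lmulP a; move: s; apply: ptensor_eq => [||b c].
- exact: (bounded_linear_comp lP (bmul_r t)).
- exact: (bounded_linear_comp (bmul_r t) lP).
move: t; apply: ptensor_eq => [||d e].
- exact: (bounded_linear_comp lP (bmul_l _)).
- exact: bmul_l.
by rewrite tens_mul !lE tens_mul bmulA.
Qed.

Lemma tens_rmul_mul a (s t : T) : tens_rmul (s ** t) a = s ** tens_rmul t a.
Proof.
have [rP rE] := tens_rmulP a; move: s; apply: ptensor_eq => [||b c].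
- exact: (bounded_linear_comp rP (bmul_r t)).
- exact: bmul_r.
move: t; apply: ptensor_eq => [||d e].
- exact: (bounded_linear_comp rP (bmul_l _)).
- exact: (bounded_linear_comp (bmul_l _) rP).
by rewrite tens_mul !rE tens_mul bmulA.
Qed.

(** The maps a (x) b |-> amb, where m ranges over A with a unit adjoined: [None]
    stands for the unit, for which the map is omega. *)
Definition omega_mid (o : option A) (t : T) : A :=
  omega (if o is Some m then tens_map id (bmul m) t else t).

Lemma omega_midP (o : option A) : bounded_linear (omega_mid o).
Proof.
have [wP _] := omegaP A; case: o => [m|] //.
have [mP _] := tens_mapP (@bounded_linear_id _ A) (bmul_l m).
exact: bounded_linear_comp.
Qed.

Lemma omega_mid_tens o a b :
  omega_mid o (tens a b) = a ** (if o is Some m then m ** b else b).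
Proof.
rewrite /omega_mid; case: o => [m|]; last by rewrite (omegaP A).2.
by rewrite (tens_mapP (@bounded_linear_id _ A) (bmul_l m)).2 (omegaP A).2.
Qed.

(** Multiplying a tensor by an elementary one turns one map [omega_mid] into
    another, up to a factor in A: (a (x) b)(c (x) d) = ac (x) bd is sent by
    the map with middle m to a (c (mb) d). *)
Lemma omega_mid_mull o a b t : omega_mid o (tens a b ** t) =
  a ** omega_mid (Some (if o is Some m then m ** b else b)) t.
Proof.
move: t; apply: ptensor_eq => [||c d].
- exact: (bounded_linear_comp (omega_midP _) (bmul_l _)).
- exact: (bounded_linear_comp (bmul_l _) (omega_midP _)).
by rewrite tens_mul !omega_mid_tens; case: o => [m|]; rewrite !bmulA.
Qed.

Lemma omega_mid_mulr o a b t : omega_mid o (t ** tens a b) =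
  omega_mid (Some (if o is Some m then a ** m else a)) t ** b.
Proof.
move: t; apply: ptensor_eq => [||c d].
- exact: (bounded_linear_comp (omega_midP _) (bmul_r _)).
- exact: (bounded_linear_comp (bmul_r _) (omega_midP _)).
by rewrite tens_mul !omega_mid_tens; case: o => [m|]; rewrite !bmulA.
Qed.

(** The preimage of N under omega alone need not be an ideal: inner factors
    appear between the two legs of a tensor, and the whole family absorbs
    them. *)
Lemma omega_mid_ideal (N : {pred A}) :
  closed_ideal N -> closed_ideal (preimages omega_mid N).
Proof.
move=> [Nsm Ncl Nmul]; apply: closed_ideal_ptensor.
- exact: (preimages_submod_closed omega_midP).
- exact: (preimages_closed omega_midP).
move=> a b t /asboolP tK; split; apply/asboolP => o.
  by rewrite omega_mid_mull; exact: (Nmul a _ (tK _)).1.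
by rewrite omega_mid_mulr; exact: (Nmul b _ (tK _)).2.
Qed.

End Ideals.

(** * The ideals I and J under a trivial left action *)

Section TrivialLeftAction.
Variables (R : realType) (U A : banachAlgType R) (M : compat_bimodule U A).
Variable f : U -> R[i].
Hypothesis lact_f : forall al a, lact M al a = f al *: a.
Local Notation T := (ptensor A A).

(** As al acts on the left through f, this is al . b - b . al. *)
Definition act_defect al b : A := f al *: b - ract M b al.

Lemma act_defect_mul al a b : act_defect al (a ** b) = a ** act_defect al b.
Proof.
by rewrite /act_defect ract_mul (bounded_linearB (bmul_l a))
  (bounded_linearZ (bmul_l a)).
Qed.

Lemma idealI_genE al a b :
  tens (lact M al a) b - tens a (ract M b al) = tens a (act_defect al b) :> T.
Proof.
rewrite lact_f (bounded_linearB (tens_l a)) (bounded_linearZ (tens_l a)).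
by rewrite (bounded_linearZ (tens_r b)).
Qed.

Lemma tens_act_defect al a b : tens a (act_defect al b) \in idealI M.
Proof. by apply: ideal_gen_sub; exists al, a, b; rewrite idealI_genE. Qed.

Lemma idealI_min (K : {pred T}) : closed_ideal K ->
  (forall al a b, tens a (act_defect al b) \in K) -> {subset idealI M <= K}.
Proof.
move=> Kid Kgen; apply: ideal_gen_min => // t [al [a [b ->]]].
by rewrite idealI_genE.
Qed.

Lemma tens_lact_f al t : tens_lact M al t = f al *: t.
Proof.
have [lP lE] := tens_lactP M al; move: t.
apply: (ptensor_eq lP (@bounded_linear_scale _ T (f al))) => b c.
by rewrite lE lact_f (bounded_linearZ (tens_r c)).
Qed.

Lemma tens_ract_f al t : f al *: t - tens_ract M t al \in idealI M.
Proof.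
have [rP rE] := tens_ractP M al.
have nP : bounded_linear (fun t => - tens_ract M t al).
  have [rl [N rN]] := rP; split=> [c x y|].
    by rewrite rl opprD scalerN.
  by exists N => x; rewrite rnormN.
have idP := @bounded_linear_id R T.
move: t; apply: (ptensor_in (bounded_linearD (f al) idP nP)) => a b.
rewrite rE -(bounded_linearZ (tens_l a)).
by rewrite -(bounded_linearB (tens_l a)) tens_act_defect.
Qed.

Lemma idealI_lmul a t : t \in idealI M -> tens_lmul a t \in idealI M.
Proof.
have [lP lE] := tens_lmulP a; apply: ideal_gen_multiplier => //.
  by left; exact: tens_lmul_mul.
by move=> _ [al [b [c ->]]]; rewrite idealI_genE lE; exact: tens_act_defect.
Qed.

Lemma tens_rmul_act_defect al b t : tens_rmul t (act_defect al b) \in idealI M.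
Proof.
have [rP rE] := tens_rmulP (act_defect al b).
move: t; apply: (ptensor_in rP) => c d.
by rewrite rE -act_defect_mul tens_act_defect.
Qed.

(** If e is a left identity modulo J, then the defect d equals e d modulo J,
    which is the image under omega of the generator e (x) d of I. *)
Lemma act_defect_idealJ al b :
  has_left_identity (idealJ M) -> act_defect al b \in idealJ M.
Proof.
move=> [e eL]; have := eL (npi (idealJ M) (act_defect al b)).
rewrite -[e]nrepK qmulE; last exact: idealJ_closed_ideal.
have -> : npi (idealJ M) (qrep e ** act_defect al b) = 0.
  apply/qpi_eq0; apply: ideal_gen_sub; exists (tens (qrep e) (act_defect al b)).
    exact: tens_act_defect.
  exact: (omegaP A).2.
by move=> /esym/qpi_eq0.
Qed.

(** * The morphism induced by a bimodule splitting *)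

Section Biprojective.
Variable rho : A -> T.
Hypothesis rhoP : bounded_linear rho.
Hypothesis rho_l : forall a b, rho (a ** b) = tens_lmul a (rho b).
Hypothesis rho_r : forall a b, rho (a ** b) = tens_rmul (rho a) b.
Hypothesis rhoK : forall a, omega (rho a) = a.

(** For a generator b (x) d of I, the tensor b (x) dc lies in I when b is a
    product pq, being (p (x) d)(q (x) c).  Writing b = omega (rho b) reduces
    the general case to this one by continuity. *)
Lemma idealI_rmul a t : t \in idealI M -> tens_rmul t a \in idealI M.
Proof.
have [rP rE] := tens_rmulP a; apply: (ideal_gen_multiplier rP).
  by right; exact: tens_rmul_mul.
move=> _ [al [b [c ->]]]; rewrite idealI_genE rE -(rhoK b).
have [wP wE] := omegaP A.
apply: (ptensor_in (bounded_linear_comp (tens_r _) wP)) => p q.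
rewrite wE -tens_mul.
have [_ _ Imul] := idealI_closed_ideal M.
by case: (Imul (tens q a) _ (tens_act_defect al p c)).
Qed.

(** Two minimality arguments: J is contained in the closed ideal N of elements
    that rho sends into I, because omega maps I into N; and omega does so
    because I is contained in the closed ideal of tensors that every
    [omega_mid] sends into N.  On a generator of I this reads
    rho (a d) = rho a . d. *)
Lemma rho_idealJ a : a \in idealJ M -> rho a \in idealI M.
Proof.
pose N := preimages (fun _ : unit => rho) (idealI M).
have Nid : closed_ideal N.
  move: (idealI_closed_ideal M) => [Ism Icl _].
  split; [exact: preimages_submod_closed|exact: preimages_closed|].
  move=> b c /asboolP/(_ tt) cN; split; apply/asboolP => _.
    by rewrite rho_l idealI_lmul.
  by rewrite rho_r idealI_rmul.
suff wN t : t \in idealI M -> omega t \in N.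
  move=> aJ; suff /asboolP/(_ tt) : a \in N by [].
  by apply: (ideal_gen_min Nid _ aJ) => _ [t tI <-]; exact: wN.
move=> tI; suff /asboolP/(_ None) : t \in preimages (@omega_mid R A) N by [].
apply: (idealI_min (omega_mid_ideal Nid) _ tI) => al b c.
apply/asboolP => o; apply/asboolP => _; rewrite omega_mid_tens.
by case: o => [m|]; rewrite ?bmulA rho_r tens_rmul_act_defect.
Qed.

Definition rho_tilde (x : nquot (idealJ M)) : nquot (idealI M) :=
  npi (idealI M) (rho (qrep x)).

Lemma rho_tildeE a : rho_tilde (npi (idealJ M) a) = npi (idealI M) (rho a).
Proof.
by apply/npi_eq; rewrite -bounded_linearB //; apply: rho_idealJ; exact: qpi_rep.
Qed.

Lemma rho_tilde_bounded_linear : bounded_linear rho_tilde.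
Proof.
have [rl [B rB]] := rhoP; split=> [c x y|].
  rewrite -[x]nrepK -[y]nrepK -linearP !rho_tildeE rl; exact: linearP.
(* A positive bound can be divided out, which leaves a lower bound for the
   infimum defining the quotient norm of x. *)
have B0 : 0 < `|B| + 1 by rewrite ltr_wpDl.
exists (`|B| + 1) => x; rewrite mulrC -ler_pdivrMr //.
apply: gauge_ge => [v|y|a <-]; first exact: rnorm_ge0.
  by exists (qrep y); exact: nrepK.
rewrite ler_pdivrMr // mulrC rho_tildeE.
have /le_trans : rnorm (npi (idealI M) (rho a)) <= rnorm (rho a).
  by rewrite -lecR -!rnormE npi_norm_le.
apply; apply: (le_trans (rB a)); rewrite ler_wpM2r ?rnorm_ge0 //.
by rewrite (le_trans (ler_norm B)) // lerDl.
Qed.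

(** It is enough to compare on the representative rho a of the image of a,
    provided that h descends modulo I. *)
Lemma rho_tilde_intertwines (g : A -> A) (h : T -> T) :
  bounded_linear h -> (forall t, t \in idealI M -> h t \in idealI M) ->
  (forall a, npi (idealI M) (rho (g a)) = npi (idealI M) (h (rho a))) ->
  intertwines rho_tilde g h.
Proof.
move=> hP hI e a t; rewrite !rho_tildeE e => /npi_eq at_.
by apply/npi_eq; rewrite -bounded_linearB //; exact: hI.
Qed.

Lemma rho_tilde_module_morphism :
  has_left_identity (idealJ M) -> module_morphism rho_tilde.
Proof.
move=> JL; have phiP := rho_tilde_bounded_linear; have [phil _] := phiP.
have ract_f t al : npi (idealI M) (tens_ract M t al) = f al *: npi (idealI M) t.
  by rewrite -linearZ; apply/esym/npi_eq; exact: tens_ract_f.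
split.
- exact: bounded_linear_continuous.
- by move=> x y; have := phil 1 x y; rewrite !scale1r.
- move=> al; split; apply: rho_tilde_intertwines.
  + by case: (tens_lactP M al).
  + move=> t tI; rewrite tens_lact_f; apply/qpi_eq0.
    by rewrite linearZ /= (qpi_eq0 _ _).2 ?scaler0.
  + by move=> a; rewrite lact_f tens_lact_f (bounded_linearZ rhoP).
  + by case: (tens_ractP M al).
  + move=> t /qpi_eq0 tI; apply/qpi_eq0.
    by rewrite -/(npi _ _) ract_f /npi tI scaler0.
  + move=> a; rewrite ract_f -linearZ -(bounded_linearZ rhoP).
    apply/esym/npi_eq; rewrite -bounded_linearB //; apply: rho_idealJ.
    exact: act_defect_idealJ.
- move=> a; split; apply: rho_tilde_intertwines.
  + by case: (tens_lmulP a).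
  + exact: idealI_lmul.
  + by move=> b; rewrite rho_l.
  + by case: (tens_rmulP a).
  + exact: idealI_rmul.
  + by move=> b; rewrite rho_r.
Qed.

End Biprojective.
End TrivialLeftAction.

Theorem proposition2p4 (R : realType) (U A : banachAlgType R)
    (M : compat_bimodule U A) :
  left_trivial M ->
  has_left_identity (idealJ M) ->
  biprojective A ->
  module_biprojective M.
Proof.
move=> [f _ lact_f] JL [rho [rl rB rho_l rho_r rhoK]].
have rhoP : bounded_linear rho by [].
exists (rho_tilde rho); split.
- by have [] := rho_tilde_bounded_linear lact_f rhoP rho_l rho_r rhoK.
- exact: (rho_tilde_module_morphism lact_f).
- by move=> x; rewrite /rho_tilde omega_tildeE rhoK nrepK.
Qed.
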